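(* Let $\nu\in\mathbb{R}$, $\nu'>0$, and let $u,v\in\mathbb{C}$ be such that $uv\in\mathbb{R}$ and $\nu\nu' uv<1$. Then for all nonnegative integers $j,k$ and all $z\in\mathbb{C}$, $$\int_{\mathbb{C}} \exp\left(\frac{-\nu'|w|^2+\nu\nu'\,(u z w+v\,\overline{z}\,\overline{w})}{1-\nu\nu' uv}\right) H_{k,j}^{\nu'}(w,\overline{w})\, d\lambda(w) = \pi\,(\nu')^{j+k-1}\,(1-\nu\nu' uv)\,u^j v^k\, \exp\left(\frac{\nu^2\nu' uv}{1-\nu\nu' uv}\,|z|^2\right) H_{j,k}^{\nu}(z,\overline{z}).$$
   Context: Here $\lambda$ is Lebesgue measure on $\mathbb{C}$. For a real number $\nu$ and nonnegative integers $m,n$, the (weighted) univariate complex Hermite polynomials are $$H_{m,n}^{\nu}(z,\overline{z}) = (-1)^{m+n} e^{\nu z\overline{z}}\, \frac{\partial^{m+n}}{\partial \overline{z}^{m}\,\partial z^{n}}\left(e^{-\nu z\overline{z}}\right),\qquad z\in\mathbb{C},$$ where $\partial/\partial z=\frac12(\partial_x-i\partial_y)$ and $\partial/\partial\overline{z}=\frac12(\partial_x+i\partial_y)$ for $z=x+iy$ are the Wirtinger derivatives. *)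

(* Defs.v *)
From HB Require Import structures.
From mathcomp Require Import all_boot all_order all_algebra.
From mathcomp Require Import all_classical all_reals all_analysis.
From mathcomp Require Import complex.

Set Implicit Arguments.
Unset Strict Implicit.
Unset Printing Implicit Defensive.

Import Order.TTheory GRing.Theory Num.Theory.
Import numFieldNormedType.Exports.

Local Open Scope classical_set_scope.
Local Open Scope ring_scope.
Local Open Scope complex_scope.

Section Wirtinger.
Context {R : realType}.
Implicit Types (f : R[i] -> R[i]) (z : R[i]).

Definition cexp z : R[i] :=
  (expR (complex.Re z))%:C * (cos (complex.Im z) +i* sin (complex.Im z)).

(* The analysis library has no normed R-module structure on R[i], so the
   derivative is taken separately on the real and imaginary parts. *)
Definition partial_x f z : R[i] :=
  derive1 (fun x : R => complex.Re (f (x +i* complex.Im z))) (complex.Re z) +i*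
  derive1 (fun x : R => complex.Im (f (x +i* complex.Im z))) (complex.Re z).

Definition partial_y f z : R[i] :=
  derive1 (fun y : R => complex.Re (f (complex.Re z +i* y))) (complex.Im z) +i*
  derive1 (fun y : R => complex.Im (f (complex.Re z +i* y))) (complex.Im z).

Definition wirtinger f z : R[i] :=
  2^-1 * (partial_x f z - 'i%C * partial_y f z).

Definition wirtinger_bar f z : R[i] :=
  2^-1 * (partial_x f z + 'i%C * partial_y f z).

Definition cHermite (m n : nat) (nu : R) z : R[i] :=
  (-1) ^+ (m + n) * cexp (nu%:C * z * z^*) *
  iter m wirtinger_bar
    (iter n wirtinger (fun w => cexp (- (nu%:C * w * w^*)))) z.

End Wirtinger.

Section IntegralC.
Context {R : realType}.
Implicit Type f : R[i] -> R[i].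

(* Lebesgue measure on C is the product measure on R * R, a point (x, y) of
   the plane standing for x +i* y. *)
Local Notation lebesgue2 :=
  (@lebesgue_measure R \x @lebesgue_measure R)%E.

Definition cintegrable f : Prop :=
  lebesgue2.-integrable setT
    (fun p => (complex.Re (f (p.1 +i* p.2)))%:E) /\
  lebesgue2.-integrable setT
    (fun p => (complex.Im (f (p.1 +i* p.2)))%:E).

Definition cintegral f : R[i] :=
  Rintegral lebesgue2 setT (fun p => complex.Re (f (p.1 +i* p.2))) +i*
  Rintegral lebesgue2 setT (fun p => complex.Im (f (p.1 +i* p.2))).

End IntegralC.

(* Main.v *)
(* Both sides satisfy the same recursion.  The polynomials H_{m,n} obey
   H_{m+1,n} = nu z H_{m,n} - nu n H_{m,n-1} and its mirror image in n, together
   with d/dz^* H_{m,n} = nu n H_{m,n-1}.  For the weight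
   exp (- a |w|^2 + b w + c w^* ), with a = nu'/D, integration by parts gives
   a int w f = c int f + int df/dw^*, hence a recursion in k for the integral
   of H_{k,j}, and the mirror rule handles k = 0.  Since
   nu'/a = D = 1 - nu nu' u v, this is the recursion of the right-hand side.
   The starting value (pi / a) exp (b c / a) is a product of two Gaussian
   integrals on the line with complex linear terms. *)

Require Import Defs.
From mathcomp Require Import all_boot all_order all_algebra.
From mathcomp Require Import all_classical all_reals all_analysis.
From mathcomp Require Import complex.
From mathcomp Require Import measurable_realfun ring.

Set Implicit Arguments.
Unset Strict Implicit.
Unset Printing Implicit Defensive.

Import Order.TTheory GRing.Theory Num.Theory.
Import numFieldNormedType.Exports.

Local Open Scope ring_scope.
Local Open Scope complex_scope.

(** * The exponential on [R[i]] and its real and imaginary parts *)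

Section ComplexExponential.
Context {R : realType}.
Implicit Types z w : R[i].

Lemma complex_ReM z w : complex.Re (z * w) =
  complex.Re z * complex.Re w - complex.Im z * complex.Im w.
Proof. by case: z w => [a b] [c d]. Qed.

Lemma complex_ImM z w : complex.Im (z * w) =
  complex.Re z * complex.Im w + complex.Im z * complex.Re w.
Proof. by case: z w => [a b] [c d]. Qed.

Lemma complex_ReD z w : complex.Re (z + w) = complex.Re z + complex.Re w.
Proof. by case: z w => [a b] [c d]. Qed.

Lemma complex_ImD z w : complex.Im (z + w) = complex.Im z + complex.Im w.
Proof. by case: z w => [a b] [c d]. Qed.

Lemma complex_ext z w : complex.Re z = complex.Re w ->
  complex.Im z = complex.Im w -> z = w.
Proof. by case: z w => [a b] [c d] /= -> ->. Qed.

Lemma cexp0 : cexp 0 = 1 :> R[i].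
Proof. by apply: complex_ext; rewrite /cexp /= expR0 cos0 sin0; ring. Qed.

Lemma cexpD z w : cexp (z + w) = cexp z * cexp w.
Proof.
case: z w => [a b] [c d]; apply: complex_ext; rewrite /cexp /= expRD ?cosD
  ?sinD; ring.
Qed.

Lemma cexpN z : cexp (- z) * cexp z = 1.
Proof. by rewrite -cexpD addNr cexp0. Qed.

Lemma Re_cexp z : complex.Re (cexp z) = expR (complex.Re z) * cos (complex.Im
  z).
Proof. by rewrite /cexp complex_ReM /= mul0r subr0. Qed.

Lemma Im_cexp z : complex.Im (cexp z) = expR (complex.Re z) * sin (complex.Im
  z).
Proof. by rewrite /cexp complex_ImM /= mul0r addr0. Qed.

Lemma cexp_real (x : R) : cexp x%:C = (expR x)%:C.
Proof. by apply: complex_ext; rewrite ?Re_cexp ?Im_cexp /= ?cos0 ?sin0; ring.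
  Qed.

End ComplexExponential.

(** * Derivatives of complex-valued functions of one real variable *)

Section ComplexDerivative.
Context {R : realType}.
Implicit Types (f g : R -> R[i]) (x : R).

(** Taken componentwise, to match the way [partial_x] and [partial_y] are defined. *)
Definition is_cderive f x (d : R[i]) : Prop :=
  is_derive x 1 (fun t => complex.Re (f t)) (complex.Re d) /\
  is_derive x 1 (fun t => complex.Im (f t)) (complex.Im d).

Lemma is_cderive_eq f x d d' : is_cderive f x d -> d = d' -> is_cderive f x d'.
Proof. by move=> ? <-. Qed.

Lemma is_cderive_cst c x : is_cderive (fun=> c) x 0.
Proof. by split; exact: is_derive_cst. Qed.

Lemma is_cderive_id x : is_cderive (fun t => t%:C) x 1.
Proof. by split; [exact: is_derive_id | exact: is_derive_cst]. Qed.

Lemma is_cderiveD f g x df dg : is_cderive f x df -> is_cderive g x dg ->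
  is_cderive (fun t => f t + g t) x (df + dg).
Proof.
move=> [fr fi] [gr gi]; split.
- under eq_fun do rewrite complex_ReD.
  by rewrite complex_ReD; exact: is_deriveD.
- under eq_fun do rewrite complex_ImD.
  by rewrite complex_ImD; exact: is_deriveD.
Qed.

Lemma is_cderiveM f g x df dg : is_cderive f x df -> is_cderive g x dg ->
  is_cderive (fun t => f t * g t) x (df * g x + f x * dg).
Proof.
move=> [fr fi] [gr gi]; split.
- under eq_fun do rewrite complex_ReM.
  apply: (is_derive_eq (is_deriveB (is_deriveM fr gr) (is_deriveM fi gi))).
  by rewrite complex_ReD !complex_ReM /GRing.scale /=; ring.
- under eq_fun do rewrite complex_ImM.
  apply: (is_derive_eq (is_deriveD (is_deriveM fr gi) (is_deriveM fi gr))).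
  by rewrite complex_ImD !complex_ImM /GRing.scale /=; ring.
Qed.

Lemma is_cderive_cexp f x d : is_cderive f x d ->
  is_cderive (fun t => cexp (f t)) x (d * cexp (f x)).
Proof.
move=> [fr fi].
have E : is_derive x 1 (fun t => expR (complex.Re (f t)))
    (complex.Re d * expR (complex.Re (f x))).
  exact: (is_derive_eq (is_derive1_comp (is_derive_expR _) fr) (mulrC _ _)).
have C : is_derive x 1 (fun t => cos (complex.Im (f t)))
    (complex.Im d * - sin (complex.Im (f x))).
  exact: (is_derive_eq (is_derive1_comp (is_derive_cos _) fi) (mulrC _ _)).
have S : is_derive x 1 (fun t => sin (complex.Im (f t)))
    (complex.Im d * cos (complex.Im (f x))).
  exact: (is_derive_eq (is_derive1_comp (is_derive_sin _) fi) (mulrC _ _)).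
split.
- under eq_fun do rewrite Re_cexp.
  apply: (is_derive_eq (is_deriveM E C)).
  by rewrite complex_ReM Re_cexp Im_cexp /GRing.scale /=; ring.
- under eq_fun do rewrite Im_cexp.
  apply: (is_derive_eq (is_deriveM E S)).
  by rewrite complex_ImM Re_cexp Im_cexp /GRing.scale /=; ring.
Qed.

Lemma is_cderiveZ c f x d : is_cderive f x d ->
  is_cderive (fun t => c * f t) x (c * d).
Proof.
move=> fd; apply: is_cderive_eq (is_cderiveM (is_cderive_cst c x) fd) _; ring.
Qed.

Lemma is_cderiveX n f x d : is_cderive f x d ->
  is_cderive (fun t => f t ^+ n) x (n%:R * f x ^+ n.-1 * d).
Proof.
move=> fd; elim: n => [|n IHn].
  by apply: is_cderive_eq (is_cderive_cst _ _) _; rewrite !mul0r.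
under eq_fun do rewrite exprS.
apply: is_cderive_eq (is_cderiveM fd IHn) _.
(* For n = 0 the truncated predecessor is harmless, since it comes with the factor [0%:R]. *)
by case: n {IHn} => [|n] /=; rewrite ?exprS -?[n.+2%:R]natr1; ring.
Qed.

Lemma is_cderive_continuous f x d : is_cderive f x d ->
  {for x, continuous (fun t => complex.Re (f t))} /\
  {for x, continuous (fun t => complex.Im (f t))}.
Proof.
by move=> [[fr _] [fi _]]; split; apply: differentiable_continuous;
  exact/derivable1_diffP.
Qed.

Lemma partial_xE (f : R[i] -> R[i]) z d :
  is_cderive (fun t => f (t +i* complex.Im z)) (complex.Re z) d ->
  partial_x f z = d.
Proof.
move=> [fr fi]; rewrite /partial_x !derive1E.
by rewrite (@derive_val _ _ _ _ _ _ _ fr) (@derive_val _ _ _ _ _ _ _ fi); case: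
  d {fr fi}.
Qed.

Lemma partial_yE (f : R[i] -> R[i]) z d :
  is_cderive (fun t => f (complex.Re z +i* t)) (complex.Im z) d ->
  partial_y f z = d.
Proof.
move=> [fr fi]; rewrite /partial_y !derive1E.
by rewrite (@derive_val _ _ _ _ _ _ _ fr) (@derive_val _ _ _ _ _ _ _ fi); case:
  d {fr fi}.
Qed.

End ComplexDerivative.

(** * Complex integrals over a general measure space *)

Section ComplexIntegral.
Context d (T : measurableType d) (R : realType) (mu : {measure set T -> \bar
  R}).
Implicit Types f g : T -> R[i].

(** Stated for an arbitrary measure so that the same rules serve the line and the plane; for the
    product measure on the plane it unfolds to [cintegrable], and [Cint] to [cintegral]. *)
Definition Cintegrable f : Prop :=
  mu.-integrable setT (EFin \o (fun t => complex.Re (f t))) /\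
  mu.-integrable setT (EFin \o (fun t => complex.Im (f t))).

Definition Cint f : R[i] :=
  Rintegral mu setT (fun t => complex.Re (f t)) +i*
  Rintegral mu setT (fun t => complex.Im (f t)).

Lemma Re_Cint f :
  complex.Re (Cint f) = Rintegral mu setT (fun t => complex.Re (f t)).
Proof. by []. Qed.

Lemma Im_Cint f :
  complex.Im (Cint f) = Rintegral mu setT (fun t => complex.Im (f t)).
Proof. by []. Qed.

Let integrableRZ (c : R) (h : T -> R) : mu.-integrable setT (EFin \o h) ->
  mu.-integrable setT (EFin \o (fun t => c * h t)).
Proof. by move=> hi; exact: (@integrableZl _ _ _ mu setT _ c _ hi). Qed.

Let integrableRB (h k : T -> R) : mu.-integrable setT (EFin \o h) ->
  mu.-integrable setT (EFin \o k) ->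
  mu.-integrable setT (EFin \o (fun t => h t - k t)).
Proof. by move=> hi ki; exact: (@integrableB _ _ _ mu setT _ _ _ hi ki). Qed.

Let integrableRD (h k : T -> R) : mu.-integrable setT (EFin \o h) ->
  mu.-integrable setT (EFin \o k) ->
  mu.-integrable setT (EFin \o (fun t => h t + k t)).
Proof. by move=> hi ki; exact: (@integrableD _ _ _ mu setT _ _ _ hi ki). Qed.

Lemma CintegrableD f g : Cintegrable f -> Cintegrable g ->
  Cintegrable (fun t => f t + g t).
Proof.
move=> [fr fi] [gr gi]; split.
- by under eq_fun do rewrite complex_ReD; exact: integrableRD.
- by under eq_fun do rewrite complex_ImD; exact: integrableRD.
Qed.

Lemma CintD f g : Cintegrable f -> Cintegrable g ->
  Cint (fun t => f t + g t) = Cint f + Cint g.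
Proof.
move=> [fr fi] [gr gi]; apply: complex_ext => /=.
- by under eq_Rintegral do rewrite complex_ReD; rewrite RintegralD.
- by under eq_Rintegral do rewrite complex_ImD; rewrite RintegralD.
Qed.

Lemma CintegrableZ c f : Cintegrable f -> Cintegrable (fun t => c * f t).
Proof.
move=> [fr fi]; split.
- under eq_fun do rewrite complex_ReM.
  by apply: integrableRB; exact: integrableRZ.
- under eq_fun do rewrite complex_ImM.
  by apply: integrableRD; exact: integrableRZ.
Qed.

Lemma CintZ c f : Cintegrable f -> Cint (fun t => c * f t) = c * Cint f.
Proof.
move=> [fr fi]; apply: complex_ext => /=.
- under eq_Rintegral do rewrite complex_ReM.
  by rewrite RintegralB ?RintegralZl ?complex_ReM//; exact: integrableRZ.
- under eq_Rintegral do rewrite complex_ImM.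
  by rewrite RintegralD ?RintegralZl ?complex_ImM//; exact: integrableRZ.
Qed.

End ComplexIntegral.

(** * Fubini and Tonelli for functions with separated variables *)

Section ProductIntegral.
Context d1 d2 (T1 : measurableType d1) (T2 : measurableType d2) (R : realType).
Context (m1 : {sigma_finite_measure set T1 -> \bar R})
  (m2 : {sigma_finite_measure set T2 -> \bar R}).

Lemma integrable_prodM (f : T1 -> R) (g : T2 -> R) :
  m1.-integrable setT (EFin \o f) -> m2.-integrable setT (EFin \o g) ->
  (m1 \x m2)%E.-integrable setT (EFin \o (fun p => f p.1 * g p.2)).
Proof.
move=> fi gi.
have mf : measurable_fun setT f by exact/measurable_EFinP/(measurable_int m1).
have mg : measurable_fun setT g by exact/measurable_EFinP/(measurable_int m2).
have mnf : measurable_fun setT (EFin \o (fun x => `|f x|)).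
  by apply/measurable_EFinP; exact: measurableT_comp.
have mng : measurable_fun setT (EFin \o (fun x => `|g x|)).
  by apply/measurable_EFinP; exact: measurableT_comp.
(* By Tonelli it suffices that the iterated integral of |f(x)| |g(y)| is finite; it factors into two
   finite integrals. *)
apply/integrable12ltyP => /=.
  by apply/measurable_EFinP; apply: measurable_funM; exact: measurableT_comp.
under eq_integral => x _.
  under eq_integral => y _ do rewrite normrM EFinM.
  rewrite ge0_integralZl// ?lee_fin//.
  over.
rewrite /= ge0_integralZr//; last exact: integral_ge0.
apply: lte_mul_pinfty; first exact: integral_ge0.
- have /integrableP[_ h] := fi.
  by rewrite ge0_fin_numE//; exact: integral_ge0.
- by have /integrableP[] := gi.
Qed.

Lemma Rintegral_prodM (f : T1 -> R) (g : T2 -> R) :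
  m1.-integrable setT (EFin \o f) -> m2.-integrable setT (EFin \o g) ->
  Rintegral (m1 \x m2)%E setT (fun p => f p.1 * g p.2) =
  Rintegral m1 setT f * Rintegral m2 setT g.
Proof.
move=> fi gi.
rewrite {1}/Rintegral -(integral12_prod_meas1 (integrable_prodM fi gi)) /=.
have -> : (\int[m1]_x fubini_F m2 (EFin \o (fun p => f p.1 * g p.2)%R) x
  = \int[m1]_x ((f x)%:E * (Rintegral m2 setT g)%:E))%E.
  apply: eq_integral => x _; rewrite /fubini_F /=.
  under eq_integral do rewrite EFinM.
  rewrite integralZl// /Rintegral fineK//.
  exact: integrable_fin_num.
rewrite integralZr// fineM//; exact: integrable_fin_num.
Qed.

Lemma Cintegrable_prodM (f : T1 -> R[i]) (g : T2 -> R[i]) :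
  Cintegrable m1 f -> Cintegrable m2 g ->
  Cintegrable (m1 \x m2)%E (fun p => f p.1 * g p.2).
Proof.
move=> [fr fi] [gr gi]; split.
- under eq_fun do rewrite complex_ReM.
  exact: (integrableB _ (integrable_prodM fr gr) (integrable_prodM fi gi)).
- under eq_fun do rewrite complex_ImM.
  exact: (integrableD _ (integrable_prodM fr gi) (integrable_prodM fi gr)).
Qed.

Lemma Cint_prodM (f : T1 -> R[i]) (g : T2 -> R[i]) :
  Cintegrable m1 f -> Cintegrable m2 g ->
  Cint (m1 \x m2)%E (fun p => f p.1 * g p.2) = Cint m1 f * Cint m2 g.
Proof.
move=> [fr fi] [gr gi]; apply: complex_ext.
- rewrite complex_ReM /= -(Rintegral_prodM fr gr) -(Rintegral_prodM fi gi).
  rewrite -(RintegralB measurableT (integrable_prodM fr gr)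
    (integrable_prodM fi gi)).
  by apply: eq_Rintegral => p _; rewrite complex_ReM.
- rewrite complex_ImM /= -(Rintegral_prodM fr gi) -(Rintegral_prodM fi gr).
  rewrite -(RintegralD measurableT (integrable_prodM fr gi)
    (integrable_prodM fi gr)).
  by apply: eq_Rintegral => p _; rewrite complex_ImM.
Qed.

End ProductIntegral.

(** * Real Gaussian integrals and decay estimates on the line *)

Section RealLine.
Context {R : realType}.
Local Open Scope classical_set_scope.
Local Notation mu := (@lebesgue_measure R).
Implicit Types (f F : R -> R) (x p a : R).

(** The integrals over [-(n+1), n+1] have two limits: the integral of f, by dominated convergence
    with bound |f|, and 0, by the fundamental theorem of calculus and the decay of F. *)
Lemma Rintegral_derive_eq0 F f :
  (forall x, is_derive x 1 F (f x)) -> continuous f ->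
  mu.-integrable setT (EFin \o f) ->
  F n.+1%:R @[n --> \oo] --> (0 : R) ->
  F (- n.+1%:R) @[n --> \oo] --> (0 : R) ->
  Rintegral mu setT f = 0.
Proof.
move=> dF cf intf Foo FNoo.
have mf : measurable_fun setT (EFin \o f) := measurable_int mu intf.
(* The successor keeps the interval nondegenerate already for n = 0. *)
pose D (n : nat) : set R := `[- n.+1%:R, n.+1%:R].
have cF : continuous F.
  move=> x; apply: differentiable_continuous; apply/derivable1_diffP.
  by have [] := dF x.
have intD n : (\int[mu]_x ((EFin \o f) \_ (D n)) x =
    (F n.+1%:R - F (- n.+1%:R))%:E)%E.
  rewrite -integral_mkcond EFinB; apply: continuous_FTC2.
  - by rewrite gtrN// ltr0n.
  - exact: continuous_subspaceT.
  - split.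
    + by move=> x _; have [] := dF x.
    + exact/cvg_at_right_filter/cF.
    + exact/cvg_at_left_filter/cF.
  - by move=> x _; rewrite derive1E; have [_ ->] := dF x.
have lim1 : (\int[mu]_x ((EFin \o f) \_ (D n)) x)%E @[n --> \oo] -->
    (\int[mu]_x (EFin \o f) x)%E.
  apply: (@dominated_cvg _ _ _ mu _ measurableT _ _
    (fun x => `|(EFin \o f) x|%E)) => //.
  - move=> n; have mD : measurable (D n) by exact: measurable_itv.
    exact: (iffLR (measurable_restrictT _ mD) (measurable_funTS mf)).
  - move=> x _; apply: cvg_near_cst.
    near=> n.
    rewrite patchE ifT// inE /D /= in_itv /= -ler_norml.
    near: n.
    (* From this rank on x lies in [D n], so the truncated integrand is constantly f(x). *)
    exists (Num.truncn `|x|) => // n /= xn.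
    rewrite (le_trans (ltW (truncnS_gt _)))// ler_nat ltnS.
    exact: xn.
  - exact: integrable_abse.
  - by move=> n x _; rewrite patchE; case: ifPn => //= _; rewrite normr0
      lee_fin.
have lim2 : (\int[mu]_x ((EFin \o f) \_ (D n)) x)%E @[n --> \oo] --> (0 : R)%:E.
  under eq_cvg do rewrite intD.
  apply: cvg_EFin; first exact: nearW.
  by rewrite -[X in _ --> X](subrr 0); exact: cvgB.
by rewrite /Rintegral (cvg_unique _ lim1 lim2).
Unshelve. all: end_near. Qed.

(** For n > 0, put y = |x| / n and raise y <= exp y to the power n; then exp |x| is one of the two
    exponentials on the right. *)
Lemma normX_le_expR n x : `|x| ^+ n <= n%:R ^+ n * (expR x + expR (- x)).
Proof.
have le_abs : expR `|x| <= expR x + expR (- x).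
  by case: (ger0P x) => _; rewrite ?lerDl ?lerDr expR_ge0.
apply: le_trans (ler_wpM2l (exprn_ge0 _ (ler0n _ _)) le_abs).
case: n => [|n]; first by rewrite !expr0 mul1r -expR0 ler_expR.
have n0 : n.+1%:R != 0 :> R by rewrite pnatr_eq0.
rewrite -[in leLHS](divfK n0 `|x|) mulrC exprMn ler_wpM2l ?exprn_ge0//.
rewrite -[in leRHS](divfK n0 `|x|) [X in expR X]mulrC expRM_natl lerXn2r
  ?nnegrE ?expR_ge0//.
by apply: le_trans (expR_ge1Dx _); rewrite lerDr.
Qed.

(** A power of x is absorbed by shifting the linear coefficient p by 1 in either direction, so the
    bound stays Gaussian with the same a. *)
Lemma normX_gauss_le n a p x :
  `|x| ^+ n * expR (p * x - a * x ^+ 2) <= n%:R ^+ n *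
    (expR ((p + 1) * x - a * x ^+ 2) + expR ((p - 1) * x - a * x ^+ 2)).
Proof.
apply: le_trans (ler_wpM2r (expR_ge0 _) (normX_le_expR n x)) _.
rewrite -mulrA ler_wpM2l ?exprn_ge0// mulrDl -!expRD.
by rewrite le_eqVlt; apply/orP; left; apply/eqP; congr (expR _ + expR _); ring.
Qed.

(** Completing the square gives a normal density of mean p/(2a) and variance 1/(2a). *)
Lemma gauss_normal a p x : 0 < a ->
  expR (p * x - a * x ^+ 2) = (Num.sqrt (pi / a) * expR (p ^+ 2 / (4 * a))) *
    normal_pdf (p / (2 * a)) (Num.sqrt (2 * a)^-1) x.
Proof.
move=> a0.
have a2 : 0 < (2 * a)^-1 by rewrite invr_gt0 mulr_gt0.
rewrite normal_pdfE ?gt_eqF ?sqrtr_gt0// /normal_peak /normal_fun.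
rewrite sqr_sqrtr ?ltW//.
have -> : (2 * a)^-1 * pi *+ 2 = pi / a by field; rewrite gt_eqF.
rewrite mulrACA mulfV ?mul1r; last first.
  by rewrite gt_eqF// sqrtr_gt0 divr_gt0// pi_gt0.
rewrite -expRD; congr expR; field.
by rewrite gt_eqF.
Qed.

Lemma integrable_gauss a p : 0 < a ->
  mu.-integrable setT (EFin \o (fun x => expR (p * x - a * x ^+ 2))).
Proof.
move=> a0; under eq_fun do rewrite gauss_normal//.
exact: (integrableZl measurableT _ (integrable_normal_pdf _ _)).
Qed.

Lemma Rintegral_gauss a p : 0 < a ->
  Rintegral mu setT (fun x => expR (p * x - a * x ^+ 2)) =
  Num.sqrt (pi / a) * expR (p ^+ 2 / (4 * a)).
Proof.
move=> a0; under eq_Rintegral do rewrite gauss_normal//.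
rewrite RintegralZl//; last exact: integrable_normal_pdf.
by rewrite /Rintegral integral_normal_pdf mulr1.
Qed.

Lemma integrable_normX_gauss n a p : 0 < a ->
  mu.-integrable setT
    (EFin \o (fun x => `|x| ^+ n * expR (p * x - a * x ^+ 2))).
Proof.
move=> a0.
have ig := integrableZl measurableT (n%:R ^+ n)
  (integrableD measurableT (integrable_gauss (p + 1) a0)
    (integrable_gauss (p - 1) a0)).
apply: le_integrable ig => //.
  apply/measurable_EFinP; apply: measurable_funM.
    by apply: measurable_funX; exact: normr_measurable.
  apply: measurableT_comp => //; apply: measurable_funB.
    exact: measurable_funM.
  by apply: measurable_funM => //; exact: measurable_funX.
move=> x _ /=; rewrite lee_fin ger0_norm; last first.
  by rewrite mulr_ge0 ?exprn_ge0 ?expR_ge0.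
exact: le_trans (normX_gauss_le _ _ _ _) (ler_norm _).
Qed.

Lemma normX_gauss_cvg0 (s : nat -> R) n a p : 0 < a ->
  (forall i, `|s i| = i.+1%:R) ->
  `|s i| ^+ n * expR (p * s i - a * s i ^+ 2) @[i --> \oo] --> (0 : R).
Proof.
move=> a0 sE.
(* The gap between the exponents is the square (r - 2ax)^2 / (4a). *)
have ub r x : expR (r * x - a * x ^+ 2) <= expR (r ^+ 2 / (4 * a)).
  rewrite ler_expR -subr_ge0.
  have -> : r ^+ 2 / (4 * a) - (r * x - a * x ^+ 2) =
      (r - 2 * a * x) ^+ 2 / (4 * a) by field; rewrite gt_eqF.
  by rewrite divr_ge0 ?sqr_ge0// mulr_ge0// ltW.
(* K bounds the expression with exponent n+1 in place of n. Dividing by the extra factor |s i| = i+1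
   bounds the sequence by K times the harmonic one. *)
pose K := n.+1%:R ^+ n.+1 * (expR ((p + 1) ^+ 2 / (4 * a)) +
  expR ((p - 1) ^+ 2 / (4 * a))).
have Kh : K * harmonic i @[i --> \oo] --> (0 : R).
  by rewrite -(mulr0 K); apply: cvgMr; exact: cvg_harmonic.
apply: (@squeeze_cvgr _ _ _ _ (cst 0) _ _ _ _ _ Kh); last exact: cvg_cst.
apply: nearW => i; rewrite mulr_ge0 ?exprn_ge0 ?expR_ge0//=.
rewrite ler_pdivlMr// -sE mulrAC -exprSr.
apply: le_trans (normX_gauss_le _ _ _ _) _.
by rewrite ler_wpM2l ?exprn_ge0// lerD// ub.
Qed.

End RealLine.

(** * Gaussian moments on the line with a complex linear term *)

Section ComplexGaussian.
Context {R : realType}.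
Local Open Scope classical_set_scope.
Local Notation mu := (@lebesgue_measure R).
Implicit Types (a x : R) (b : R[i]).

Lemma is_derive_Rintegral (f df : R -> R -> R) (G : R -> R) (q : R) :
  (forall t, mu.-integrable setT (EFin \o f t)) ->
  (forall t x : R, is_derive t 1 (f^~ x) (df t x)) ->
  (forall t x, `|df t x| <= G x) -> mu.-integrable setT (EFin \o G) ->
  is_derive q 1 (fun t => Rintegral mu setT (f t)) (Rintegral mu setT (df q)).
Proof.
move=> intf dfE dfG intG.
have d1E t x : (f^~ x)^`() t = df t x.
  by rewrite derive1E; have [_ ->] := dfE t x.
(* Differentiation under the integral is applied on an open interval around q; radius 1 is
   arbitrary, since G dominates for every t. *)
have Iq : `]q - 1, q + 1[ q by rewrite /= in_itv /= ltrBlDr ltrDl ltr01.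
have G0 x : 0 <= G x := le_trans (normr_ge0 _) (dfG 0 x).
have intf' t : `]q - 1, q + 1[ t -> mu.-integrable setT (EFin \o f t).
  by move=> _; exact: intf.
have df1 t x : `]q - 1, q + 1[ t -> [set: R] x -> derivable (f^~ x) t 1.
  by move=> _ _; have [] := dfE t x.
have Gub t x : `]q - 1, q + 1[ t -> [set: R] x -> `|partial1of2 f t x| <= G x.
  by move=> _ _; rewrite /partial1of2 d1E.
split.
  exact: (derivable_under_integral measurableT Iq intf' df1 G0 intG Gub).
rewrite -derive1E.
rewrite (differentiation_under_integral measurableT Iq intf' df1 G0 intG Gub).
by apply: eq_Rintegral => x _; rewrite /partial1of2 d1E.
Qed.

Definition gauss_exp a b x : R[i] := cexp (b * x%:C - (a * x ^+ 2)%:C).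

Definition gauss_moment a b n : R[i] :=
  Cint mu (fun x => x%:C ^+ n * gauss_exp a b x).

Lemma Re_monomial_gauss a b n x :
  complex.Re (x%:C ^+ n * gauss_exp a b x) =
  x ^+ n * (expR (complex.Re b * x - a * x ^+ 2) * cos (complex.Im b * x)).
Proof.
rewrite -rmorphXn complex_ReM Re_cexp /= mul0r subr0.
by case: b => p q /=; rewrite !mulr0 !subr0 add0r.
Qed.

Lemma Im_monomial_gauss a b n x :
  complex.Im (x%:C ^+ n * gauss_exp a b x) =
  x ^+ n * (expR (complex.Re b * x - a * x ^+ 2) * sin (complex.Im b * x)).
Proof.
rewrite -rmorphXn complex_ImM Im_cexp /= mul0r addr0.
by case: b => p q /=; rewrite !mulr0 !subr0 add0r.
Qed.

Lemma norm_Re_monomial_gauss a b n x :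
  `|complex.Re (x%:C ^+ n * gauss_exp a b x)| <=
  `|x| ^+ n * expR (complex.Re b * x - a * x ^+ 2).
Proof.
rewrite Re_monomial_gauss !normrM normrX (ger0_norm (expR_ge0 _)).
rewrite ler_wpM2l ?exprn_ge0// ler_piMr ?expR_ge0//.
by rewrite ler_norml cos_geN1 cos_le1.
Qed.

Lemma norm_Im_monomial_gauss a b n x :
  `|complex.Im (x%:C ^+ n * gauss_exp a b x)| <=
  `|x| ^+ n * expR (complex.Re b * x - a * x ^+ 2).
Proof.
rewrite Im_monomial_gauss !normrM normrX (ger0_norm (expR_ge0 _)).
rewrite ler_wpM2l ?exprn_ge0// ler_piMr ?expR_ge0//.
by rewrite ler_norml sin_geN1 sin_le1.
Qed.

Lemma is_cderive_gauss a b x :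
  is_cderive (gauss_exp a b) x ((b - (2 * a)%:C * x%:C) * gauss_exp a b x).
Proof.
apply: is_cderive_cexp.
have -> : (fun t : R => b * t%:C - (a * t ^+ 2)%:C) =
    (fun t : R => b * t%:C + - a%:C * t%:C ^+ 2).
  by apply/funext => t; rewrite rmorphM rmorphXn mulNr.
apply: is_cderive_eq (is_cderiveD (is_cderiveZ _ (is_cderive_id _))
  (is_cderiveZ _ (is_cderiveX 2 (is_cderive_id _)))) _.
by rewrite rmorphM rmorph_nat; ring.
Qed.

(** The derivative is arranged as a linear combination of monomials times the Gaussian, so that each
    term integrates to a moment. *)
Lemma is_cderive_monomial_gauss a b n x :
  is_cderive (fun t => t%:C ^+ n * gauss_exp a b t) x
    (n%:R * (x%:C ^+ n.-1 * gauss_exp a b x) +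
     (b * (x%:C ^+ n * gauss_exp a b x) +
      - (2 * a)%:C * (x%:C ^+ n.+1 * gauss_exp a b x))).
Proof.
apply: is_cderive_eq (is_cderiveM (is_cderiveX n (is_cderive_id x))
  (is_cderive_gauss a b x)) _.
by rewrite exprS; ring.
Qed.

(** Since |cos| and |sin| are at most 1, both parts are dominated by |x|^n times a real Gaussian;
    measurability follows from continuity. *)
Lemma Cintegrable_monomial_gauss a b n : 0 < a ->
  Cintegrable mu (fun x => x%:C ^+ n * gauss_exp a b x).
Proof.
move=> a0; have ig := integrable_normX_gauss n (complex.Re b) a0.
have cont x := is_cderive_continuous (is_cderive_monomial_gauss a b n x).
split; apply: le_integrable ig => //.
- by apply/measurable_EFinP; apply: continuous_measurable_fun => x;
    have [] := cont x.
- move=> x _; rewrite lee_fin.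
  exact: le_trans (norm_Re_monomial_gauss _ _ _ _) (ler_norm _).
- by apply/measurable_EFinP; apply: continuous_measurable_fun => x;
    have [] := cont x.
- move=> x _; rewrite lee_fin.
  exact: le_trans (norm_Im_monomial_gauss _ _ _ _) (ler_norm _).
Qed.

(* Integration by parts: the integral over the line of the derivative of
   [x^n gauss_exp a b x] vanishes. *)
Lemma gauss_moment_rec a b n : 0 < a ->
  (2 * a)%:C * gauss_moment a b n.+1 =
  b * gauss_moment a b n + n%:R * gauss_moment a b n.-1.
Proof.
move=> a0; have intg m := Cintegrable_monomial_gauss b m a0.
pose F x := x%:C ^+ n * gauss_exp a b x.
pose f x := n%:R * (x%:C ^+ n.-1 * gauss_exp a b x) +
  (b * (x%:C ^+ n * gauss_exp a b x) +
   - (2 * a)%:C * (x%:C ^+ n.+1 * gauss_exp a b x)).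
have dF x : is_cderive F x (f x) := is_cderive_monomial_gauss a b n x.
have cf x := is_cderive_continuous (is_cderiveD
  (is_cderiveZ n%:R (is_cderive_monomial_gauss a b n.-1 x))
  (is_cderiveD (is_cderiveZ b (is_cderive_monomial_gauss a b n x))
  (is_cderiveZ (- (2 * a)%:C) (is_cderive_monomial_gauss a b n.+1 x)))).
have intf : Cintegrable mu f.
  by apply: CintegrableD; [|apply: CintegrableD]; exact: CintegrableZ.
(* Only |s i| matters, so one squeeze treats both ends of the line. *)
have cvgF (s : nat -> R) : (forall i, `|s i| = i.+1%:R) ->
    complex.Re (F (s i)) @[i --> \oo] --> (0 : R) /\
    complex.Im (F (s i)) @[i --> \oo] --> (0 : R).
  move=> sE; have s0 := normX_gauss_cvg0 n (complex.Re b) a0 sE.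
  split; apply: norm_cvg0; apply: (@squeeze_cvgr _ _ _ _ (cst 0) _ _ _ _ _ s0);
    try exact: cvg_cst; apply: nearW => i /=; rewrite normr_ge0 /=.
  - exact: norm_Re_monomial_gauss.
  - exact: norm_Im_monomial_gauss.
have [ReP ImP] := cvgF (fun i => i.+1%:R) (fun i => ger0_norm (ler0n _ _)).
have [ReN ImN] := cvgF (fun i => - i.+1%:R)
  (fun i => etrans (normrN _) (ger0_norm (ler0n _ _))).
have f0 : Cint mu f = 0.
  apply: complex_ext; rewrite /=.
  - apply: (@Rintegral_derive_eq0 _ (fun x => complex.Re (F x))) => //.
    + by move=> x; have [] := dF x.
    + by move=> x; have [] := cf x.
    + by have [] := intf.
  - apply: (@Rintegral_derive_eq0 _ (fun x => complex.Im (F x))) => //.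
    + by move=> x; have [] := dF x.
    + by move=> x; have [] := cf x.
    + by have [] := intf.
move: f0; rewrite /f !CintD ?CintZ//.
- rewrite -!/(gauss_moment _ _ _) => /eqP.
  by rewrite mulNr addrA subr_eq0 => /eqP <-; rewrite addrC.
- exact: CintegrableZ.
- exact: CintegrableZ.
- exact: CintegrableZ.
- by apply: CintegrableD; exact: CintegrableZ.
Qed.

(** Differentiating under the integral in Im b brings down a factor ix. The bound |x| exp (px -
    ax^2) is the same for every value of Im b. *)
Lemma is_cderive_gauss_moment0 a (p q : R) : 0 < a ->
  is_cderive (fun t => gauss_moment a (p +i* t) 0) q
    ('i%C * gauss_moment a (p +i* q) 1).
Proof.
move=> a0; have intG := integrable_normX_gauss 1 p a0.
have intg t n := Cintegrable_monomial_gauss (p +i* t) n a0.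
have dlin (x t : R) : is_derive t 1 (fun t : R => t * x) x.
  apply: is_derive_eq (is_deriveM (is_derive_id _ _) (is_derive_cst _ _ _)) _.
  by rewrite /GRing.scale /=; ring.
split.
- rewrite [X in is_derive _ _ _ X](_ : _ = Rintegral mu setT (fun x =>
      - (x ^+ 1 * (expR (p * x - a * x ^+ 2) * sin (q * x))))); last first.
    rewrite complex_ReM mul0r mul1r sub0r -mulN1r.
    rewrite Im_Cint -RintegralZl//; last first.
      by have [] := intg q 1%N.
    by apply: eq_Rintegral => x _; rewrite Im_monomial_gauss /= mulN1r.
  apply: (@is_derive_Rintegral
    (fun t x => complex.Re (x%:C ^+ 0 * gauss_exp a (p +i* t) x))
    (fun t x => - (x ^+ 1 * (expR (p * x - a * x ^+ 2) * sin (t * x))))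
    _ _ _ _ _ intG).
  + by move=> t; have [] := intg t 0%N.
  + move=> t x; under eq_fun do rewrite Re_monomial_gauss expr0 mul1r /=.
    move: (expR _) => e.
    apply: is_derive_eq (is_deriveM (is_derive_cst _ _ _)
      (is_derive1_comp (is_derive_cos _) (dlin x t))) _.
    by rewrite /GRing.scale /= !mulr0; ring.
  + move=> t x; rewrite normrN.
    by have := norm_Im_monomial_gauss a (p +i* t) 1 x; rewrite
      Im_monomial_gauss.
- rewrite [X in is_derive _ _ _ X](_ : _ = Rintegral mu setT (fun x =>
      x ^+ 1 * (expR (p * x - a * x ^+ 2) * cos (q * x)))); last first.
    rewrite complex_ImM mul0r mul1r add0r Re_Cint.
    by apply: eq_Rintegral => x _; rewrite Re_monomial_gauss.
  apply: (@is_derive_Rintegral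
    (fun t x => complex.Im (x%:C ^+ 0 * gauss_exp a (p +i* t) x))
    (fun t x => x ^+ 1 * (expR (p * x - a * x ^+ 2) * cos (t * x)))
    _ _ _ _ _ intG).
  + by move=> t; have [] := intg t 0%N.
  + move=> t x; under eq_fun do rewrite Im_monomial_gauss expr0 mul1r /=.
    move: (expR _) => e.
    apply: is_derive_eq (is_deriveM (is_derive_cst _ _ _)
      (is_derive1_comp (is_derive_sin _) (dlin x t))) _.
    by rewrite /GRing.scale /= !mulr0; ring.
  + move=> t x.
    by have := norm_Re_monomial_gauss a (p +i* t) 1 x; rewrite
      Re_monomial_gauss.
Qed.

(* As a function of [Im b], [gauss_moment a b 0 * cexp (- b^2 / 4a)] has zero
   derivative, so the formula reduces to real [b]. *)
Lemma gauss_moment0 a b : 0 < a ->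
  gauss_moment a b 0 = (Num.sqrt (pi / a))%:C * cexp (b ^+ 2 / (4 * a)%:C).
Proof.
case: b => p q a0.
have aC0 : a%:C != 0 :> R[i] by rewrite fmorph_eq0 gt_eqF.
have a20 : (2 * a)%:C != 0 :> R[i] by rewrite fmorph_eq0 gt_eqF ?mulr_gt0.
pose b t : R[i] := p%:C + 'i%C * t%:C.
have bE t : p +i* t = b t by apply: complex_ext; rewrite /= !(mul0r, mul1r);
  ring.
pose K t := gauss_moment a (p +i* t) 0 * cexp (- (b t ^+ 2 / (4 * a)%:C)).
have dK t : is_cderive K t 0.
  have db : is_cderive b t 'i%C.
    apply: is_cderive_eq (is_cderiveD (is_cderive_cst p%:C t)
      (is_cderiveZ 'i%C (is_cderive_id t))) _.
    by rewrite add0r mulr1.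
  have de : is_cderive (fun t => - (b t ^+ 2 / (4 * a)%:C)) t
      (- ('i%C * b t / (2 * a)%:C)).
    have -> : (fun t => - (b t ^+ 2 / (4 * a)%:C)) =
        (fun t => - (4 * a)%:C^-1 * b t ^+ 2).
      by apply/funext => s; rewrite mulNr mulrC.
    apply: is_cderive_eq (is_cderiveZ _ (is_cderiveX 2 db)) _.
    by rewrite [2.-1]/= expr1 !rmorphM !rmorph_nat; field; exact: aC0.
  apply: is_cderive_eq
    (is_cderiveM (is_cderive_gauss_moment0 p t a0) (is_cderive_cexp de)) _.
  (* The moment recursion at n = 0 expresses the first moment through the zeroth, and the two terms
     of the derivative cancel. *)
  have -> : gauss_moment a (p +i* t) 1 =
      b t * gauss_moment a (p +i* t) 0 / (2 * a)%:C.
    apply: (mulfI a20); rewrite gauss_moment_rec// mul0r addr0 bE.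
    by rewrite mulrCA mulfV// mulr1.
  by field.
have KE : K q = K 0.
  apply: complex_ext.
  - exact: (@is_derive_0_is_cst _ (fun t => complex.Re (K t)) _ _
      (fun t => proj1 (dK t))).
  - exact: (@is_derive_0_is_cst _ (fun t => complex.Im (K t)) _ _
      (fun t => proj2 (dK t))).
have K0 : K 0 = (Num.sqrt (pi / a))%:C.
  have b0 : b 0 = p%:C by rewrite /b mulr0 addr0.
  rewrite /K b0.
  (* For real b the sine part vanishes and the real Gaussian integral remains. *)
  have -> : gauss_moment a (p +i* 0) 0 =
      (Num.sqrt (pi / a) * expR (p ^+ 2 / (4 * a)))%:C.
    apply: complex_ext.
    - rewrite Re_Cint [RHS]/= -Rintegral_gauss//; apply: eq_Rintegral => x _.
      by rewrite Re_monomial_gauss /= mul0r cos0 mulr1 mul1r.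
    - rewrite Im_Cint [RHS]/= -[RHS](mul0r (fine (mu setT))) -Rintegral_cst//.
      apply: eq_Rintegral => x _.
      by rewrite Im_monomial_gauss /= mul0r sin0 !mulr0.
  rewrite [X in X * _]rmorphM -[X in _ * X * _]cexp_real rmorphM fmorphV
    rmorphXn.
  by rewrite -mulrA [X in _ * X]mulrC cexpN mulr1.
rewrite -K0 -KE /K -mulrA -bE.
by rewrite cexpN mulr1.
Qed.

End ComplexGaussian.

(** * Polynomials on the plane, Wirtinger derivatives and the Hermite recursion *)

Section PlanePolynomials.
Context {R : realType}.
Implicit Types (f g d db : R[i] -> R[i]) (z w : R[i]) (nu : R).

Local Notation X w := (complex.Re w)%:C.
Local Notation Y w := (complex.Im w)%:C.

Lemma conjE w : Num.conj w = X w - 'i%C * Y w.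
Proof.
change (conjc w = X w - 'i%C * Y w).
by case: w => x y; apply: complex_ext; rewrite /=; ring.
Qed.

Lemma mulii : 'i%C * 'i%C = -1 :> R[i].
Proof. by rewrite -expr2 sqr_i. Qed.

(* [xy_poly f fx fy]: f is a polynomial in the real coordinates, with formal
   partial derivatives fx and fy. *)
Inductive xy_poly : (R[i] -> R[i]) -> (R[i] -> R[i]) -> (R[i] -> R[i]) -> Prop
  :=
| xy_monomial c p q :
    xy_poly (fun w => c * (X w ^+ p * Y w ^+ q))
      (fun w => c * p%:R * (X w ^+ p.-1 * Y w ^+ q))
      (fun w => c * q%:R * (X w ^+ p * Y w ^+ q.-1))
| xy_add f fx fy g gx gy : xy_poly f fx fy -> xy_poly g gx gy ->
    xy_poly (fun w => f w + g w) (fun w => fx w + gx w) (fun w => fy w + gy w).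

Lemma xy_poly_ext f fx fy g gx gy : xy_poly f fx fy ->
  f =1 g -> fx =1 gx -> fy =1 gy -> xy_poly g gx gy.
Proof. by move=> fP /funext <- /funext <- /funext <-. Qed.

Lemma xy_polyZ a f fx fy : xy_poly f fx fy ->
  xy_poly (fun w => a * f w) (fun w => a * fx w) (fun w => a * fy w).
Proof.
elim=> [c p q|{}f {}fx {}fy g gx gy _ IHf _ IHg].
  by apply: xy_poly_ext (xy_monomial (a * c) p q) _ _ _ => w; ring.
by apply: xy_poly_ext (xy_add IHf IHg) _ _ _ => w; ring.
Qed.

Lemma xy_polyX f fx fy : xy_poly f fx fy ->
  xy_poly (fun w => X w * f w) (fun w => f w + X w * fx w)
    (fun w => X w * fy w).
Proof.
elim=> [c p q|{}f {}fx {}fy g gx gy _ IHf _ IHg].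
  apply: xy_poly_ext (xy_monomial c p.+1 q) _ _ _ => w; rewrite ?exprS; first
    ring.
    by case: p => [|p] /=; rewrite ?exprS -?[in LHS]natr1; ring.
  ring.
by apply: xy_poly_ext (xy_add IHf IHg) _ _ _ => w; ring.
Qed.

Lemma xy_polyY f fx fy : xy_poly f fx fy ->
  xy_poly (fun w => Y w * f w) (fun w => Y w * fx w)
    (fun w => f w + Y w * fy w).
Proof.
elim=> [c p q|{}f {}fx {}fy g gx gy _ IHf _ IHg].
  apply: xy_poly_ext (xy_monomial c p q.+1) _ _ _ => w; rewrite ?exprS.
  - ring.
  - ring.
  - by case: q => [|q] /=; rewrite ?exprS -?[in LHS]natr1; ring.
by apply: xy_poly_ext (xy_add IHf IHg) _ _ _ => w; ring.
Qed.

(** Links the formal partial derivatives to the analytic ones along horizontal and vertical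
    lines. *)
Lemma xy_poly_cderive f fx fy z : xy_poly f fx fy ->
  is_cderive (fun t => f (t +i* complex.Im z)) (complex.Re z) (fx z) /\
  is_cderive (fun t => f (complex.Re z +i* t)) (complex.Im z) (fy z).
Proof.
elim=> [c p q|{}f {}fx {}fy g gx gy _ [fX fY] _ [gX gY]]; last first.
  by split; exact: is_cderiveD.
split.
- apply: is_cderive_eq (is_cderiveZ c (is_cderiveM
    (is_cderiveX p (is_cderive_id _)) (is_cderive_cst (Y z ^+ q) _))) _.
  ring.
- apply: is_cderive_eq (is_cderiveZ c (is_cderiveM
    (is_cderive_cst (X z ^+ p) _) (is_cderiveX q (is_cderive_id _)))) _.
  ring.
Qed.

(* d and db stand for the Wirtinger derivatives of f in z and in z^*. *)
Definition wirtinger_poly f d db : Prop :=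
  xy_poly f (fun w => d w + db w) (fun w => 'i%C * (d w - db w)).

Lemma wirtinger_poly_ext f d db g e eb : wirtinger_poly f d db ->
  f =1 g -> d =1 e -> db =1 eb -> wirtinger_poly g e eb.
Proof. by move=> fP /funext <- /funext <- /funext <-. Qed.

Lemma wirtinger_poly_cst c : wirtinger_poly (fun=> c) (fun=> 0) (fun=> 0).
Proof. by apply: xy_poly_ext (xy_monomial c 0 0) _ _ _ => w; ring. Qed.

Lemma wirtinger_polyD f d db g e eb :
  wirtinger_poly f d db -> wirtinger_poly g e eb ->
  wirtinger_poly (fun w => f w + g w) (fun w => d w + e w)
    (fun w => db w + eb w).
Proof.
by move=> fP gP; apply: xy_poly_ext (xy_add fP gP) _ _ _ => w; ring.
Qed.

Lemma wirtinger_polyZ c f d db : wirtinger_poly f d db ->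
  wirtinger_poly (fun w => c * f w) (fun w => c * d w) (fun w => c * db w).
Proof. by move=> fP; apply: xy_poly_ext (xy_polyZ c fP) _ _ _ => w; ring. Qed.

(** Product rule for w = x + iy, whose derivatives in w and in conj w are 1 and 0. *)
Lemma wirtinger_poly_mulz f d db : wirtinger_poly f d db ->
  wirtinger_poly (fun w => w * f w) (fun w => f w + w * d w)
    (fun w => w * db w).
Proof.
move=> fP.
apply: xy_poly_ext (xy_add (xy_polyX fP) (xy_polyZ 'i%C (xy_polyY fP))) _ _ _
  => w /=; move: (f w) (d w) (db w) => F D B;
  by rewrite [in RHS](complexE w); ring: mulii.
Qed.

Lemma wirtinger_poly_mulzc f d db : wirtinger_poly f d db ->
  wirtinger_poly (fun w => w^* * f w) (fun w => w^* * d w)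
    (fun w => f w + w^* * db w).
Proof.
move=> fP.
apply: xy_poly_ext (xy_add (xy_polyX fP) (xy_polyZ (- 'i%C) (xy_polyY fP))) _ _
  _
  => w /=; rewrite [in RHS](conjE w); ring: mulii.
Qed.

(** * Wirtinger derivatives of a polynomial times the exponential of a polynomial *)

Section GaussianProduct.
Variables (f d db g e eb : R[i] -> R[i]) (z : R[i]).
Hypotheses (fP : wirtinger_poly f d db) (gP : wirtinger_poly g e eb).

Let partial_fexp :
  partial_x (fun w => f w * cexp (g w)) z =
    ((d z + db z) + f z * (e z + eb z)) * cexp (g z) /\
  partial_y (fun w => f w * cexp (g w)) z =
    'i%C * ((d z - db z) + f z * (e z - eb z)) * cexp (g z).
Proof.
have [fx fy] := xy_poly_cderive z fP; have [gx gy] := xy_poly_cderive z gP.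
have zE : complex.Re z +i* complex.Im z = z by case: (z).
split.
- apply: partial_xE; apply: is_cderive_eq
    (is_cderiveM fx (is_cderive_cexp gx)) _.
  by rewrite zE; ring.
- apply: partial_yE; apply: is_cderive_eq
    (is_cderiveM fy (is_cderive_cexp gy)) _.
  by rewrite zE; ring.
Qed.

Lemma wirtinger_mul_cexp : wirtinger (fun w => f w * cexp (g w)) z =
  (d z + f z * e z) * cexp (g z).
Proof.
by rewrite /wirtinger; have [-> ->] := partial_fexp; field: mulii.
Qed.

Lemma wirtinger_bar_mul_cexp : wirtinger_bar (fun w => f w * cexp (g w)) z =
  (db z + f z * eb z) * cexp (g z).
Proof.
by rewrite /wirtinger_bar; have [-> ->] := partial_fexp; field: mulii.
Qed.

End GaussianProduct.

(** A derivative-free form of [cHermite], by recursion on the first index from H_{0,n}. At n = 0 the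
    junk index [n.-1] is multiplied by 0. *)
Fixpoint hermite nu m n z : R[i] :=
  if m is m'.+1 then
    nu%:C * (z * hermite nu m' n z - n%:R * hermite nu m' n.-1 z)
  else (nu%:C * z^*) ^+ n.

(** The mirror rule, which raises the second index. In the induction on m the two sides differ by nu
    (L - U), where [L] and [U] are the two recursions at (m, n), and these have the same right-hand
    side. *)
Lemma hermiteSr nu m n z : hermite nu m n.+1 z =
  nu%:C * (Num.conj z * hermite nu m n z - m%:R * hermite nu m.-1 n z).
Proof.
elim: m n => [|m IHm] n; first by rewrite /= exprS; ring.
(* The factor m makes the identity valid at m = 0 too; the factor n does the same in [U]. *)
have L : m%:R * (hermite nu m n z - nu%:C * z * hermite nu m.-1 n z) =
    - (nu%:C * m%:R * n%:R * hermite nu m.-1 n.-1 z).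
  by case: m {IHm} => [|m] /=; ring.
have U : n%:R * (hermite nu m n z - nu%:C * Num.conj z * hermite nu m n.-1 z) =
    - (nu%:C * n%:R * m%:R * hermite nu m.-1 n.-1 z).
  by case: n {L} => [|n] /=; [ring | rewrite IHm; ring].
rewrite [LHS]/= IHm [hermite nu m.+1 n z]/= [m.+1.-1]/=.
apply: subr0_eq.
transitivity (nu%:C *
  (m%:R * (hermite nu m n z - nu%:C * z * hermite nu m.-1 n z) -
   n%:R * (hermite nu m n z - nu%:C * Num.conj z * hermite nu m n.-1 z))).
  by rewrite -!natr1; ring.
by rewrite L U; ring.
Qed.

(** Each derivative lowers one index (Appell property); the product rule is carried through the
    defining recursion. *)
Lemma wirtinger_poly_hermite nu m n :
  wirtinger_poly (hermite nu m n)
    (fun w => nu%:C * m%:R * hermite nu m.-1 n w)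
    (fun w => nu%:C * n%:R * hermite nu m n.-1 w).
Proof.
elim: m n => [|m IHm] n.
  elim: n => [|n IHn].
    by apply: wirtinger_poly_ext (wirtinger_poly_cst 1) _ _ _ => w //=;
      rewrite ?expr0; ring.
  apply: wirtinger_poly_ext
    (wirtinger_polyZ nu%:C (wirtinger_poly_mulzc IHn)) _ _ _ => w /=.
  - by rewrite exprS; ring.
  - ring.
  - by case: n {IHn} => [|n] /=; rewrite ?exprS -?[n.+2%:R]natr1; ring.
apply: wirtinger_poly_ext (wirtinger_polyZ nu%:C (wirtinger_polyD
  (wirtinger_poly_mulz (IHm n)) (wirtinger_polyZ (- n%:R) (IHm n.-1)))) _ _ _
  => w /=.
- ring.
- case: m {IHm} => [|m] /=; first ring.
  by rewrite -[m.+2%:R]natr1; ring.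
- case: n => [|n] /=; first ring.
  ring.
Qed.

(** With s = - nu |w|^2, differentiating H_{m,n} exp s in conj w gives - H_{m+1,n} exp s: the
    lowering rule and the factor - nu w form the recursion. In w, from H_{0,n}, only the factor - nu
    conj w contributes. *)
Lemma cHermiteE nu m n z : cHermite m n nu z = hermite nu m n z.
Proof.
pose s w : R[i] := - (nu%:C * w * Num.conj w).
have sP : wirtinger_poly s (fun w => - nu%:C * Num.conj w)
    (fun w => - nu%:C * w).
  have := wirtinger_polyZ (- nu%:C)
    (wirtinger_poly_mulz (wirtinger_poly_mulzc (wirtinger_poly_cst 1))).
  by move=> /wirtinger_poly_ext; apply => w; rewrite /s; ring.
have hP k m' n' := wirtinger_polyZ ((- 1) ^+ k) (wirtinger_poly_hermite nu m'
  n').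
have it0 : iter n wirtinger (fun w => cexp (s w)) =
    (fun w => (- 1) ^+ n * hermite nu 0 n w * cexp (s w)).
  elim: {z m} n => [|n IHn]; first by apply/funext => w /=; rewrite !expr0
    !mul1r.
  rewrite iterS IHn; apply/funext => w.
  by rewrite (wirtinger_mul_cexp w (hP n 0 n) sP) /= !exprS; ring.
have it1 : iter m wirtinger_bar (iter n wirtinger (fun w => cexp (s w))) =
    (fun w => (- 1) ^+ (m + n) * hermite nu m n w * cexp (s w)).
  elim: {z} m => [|m IHm]; first by rewrite it0.
  rewrite iterS IHm; apply/funext => w.
  by rewrite (wirtinger_bar_mul_cexp w (hP (m + n)%N m n) sP) /= addSn exprS;
    ring.
have sgn : (- 1) ^+ (m + n) * (- 1) ^+ (m + n) = 1 :> R[i].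
  by rewrite -exprMn mulrNN mulr1 expr1n.
(* The prefactor of [cHermite] cancels the sign, then the exponential. *)
rewrite /cHermite it1 -[RHS]mul1r -[Z in _ = Z * _]sgn.
rewrite -[RHS]mul1r -[Z in _ = Z * _](cexpN (nu%:C * z * Num.conj z)) /s; ring.
Qed.

End PlanePolynomials.

(** * Integration against a Gaussian weight on the plane *)

Section PlaneGaussian.
Context {R : realType}.
Variables (a : R) (b c : R[i]).
Hypothesis a_gt0 : 0 < a.
Implicit Types f g d db : R[i] -> R[i].
Local Notation mu := (@lebesgue_measure R).

(** The weight exp (- a |w|^2 + b w + c conj w) in separated coordinates, using b w + c conj w = (b
    + c) x + i (b - c) y. *)
Definition plane_gauss (w : R[i]) : R[i] :=
  gauss_exp a (b + c) (complex.Re w) *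
  gauss_exp a ('i%C * (b - c)) (complex.Im w).

Local Notation G := plane_gauss.

Definition gauss_int f : R[i] := cintegral (fun w => f w * G w).
Definition gauss_integrable f : Prop := cintegrable (fun w => f w * G w).

Local Notation M := gauss_int.
Local Notation integ := gauss_integrable.

Lemma plane_gaussE w : G w =
  cexp (- a%:C * `|w| ^+ 2 + b * w + c * Num.conj w).
Proof.
rewrite /G /gauss_exp -cexpD; congr cexp.
rewrite -add_Re2_Im2 conjE [in X in _ = _ + X + _](complexE w).
by rewrite !rmorphM rmorphD !rmorphXn; ring.
Qed.

Lemma gauss_integrableD f g : integ f -> integ g -> integ (fun w => f w + g w).
Proof.
move=> fi gi; rewrite /gauss_integrable; under eq_fun do rewrite mulrDl.
exact: (CintegrableD fi gi).
Qed.

Lemma gauss_intD f g : integ f -> integ g -> M (fun w => f w + g w) = M f + M g.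
Proof.
move=> fi gi; rewrite /gauss_int; under eq_fun do rewrite mulrDl.
exact: (CintD fi gi).
Qed.

Lemma gauss_integrableZ k f : integ f -> integ (fun w => k * f w).
Proof.
move=> fi; rewrite /gauss_integrable; under eq_fun do rewrite -mulrA.
exact: (CintegrableZ k fi).
Qed.

Lemma gauss_intZ k f : integ f -> M (fun w => k * f w) = k * M f.
Proof.
move=> fi; rewrite /gauss_int; under eq_fun do rewrite -mulrA.
exact: (CintZ k fi).
Qed.

Let monomialE p q : (fun w => (complex.Re w)%:C ^+ p * (complex.Im w)%:C ^+ q *
  G w) =
  (fun w => ((complex.Re w)%:C ^+ p * gauss_exp a (b + c) (complex.Re w)) *
    ((complex.Im w)%:C ^+ q * gauss_exp a ('i%C * (b - c)) (complex.Im w))).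
Proof. by apply/funext => w; rewrite /G mulrACA. Qed.

Lemma gauss_integrable_monomial p q :
  integ (fun w => (complex.Re w)%:C ^+ p * (complex.Im w)%:C ^+ q).
Proof.
rewrite /gauss_integrable monomialE.
exact: (Cintegrable_prodM (Cintegrable_monomial_gauss _ p a_gt0)
  (Cintegrable_monomial_gauss _ q a_gt0)).
Qed.

Lemma gauss_int_monomial p q :
  M (fun w => (complex.Re w)%:C ^+ p * (complex.Im w)%:C ^+ q) =
  gauss_moment a (b + c) p * gauss_moment a ('i%C * (b - c)) q.
Proof.
rewrite /gauss_int monomialE.
exact: (Cint_prodM (Cintegrable_monomial_gauss _ p a_gt0)
  (Cintegrable_monomial_gauss _ q a_gt0)).
Qed.

(** The two line integrals each contribute sqrt (pi / a), and the exponents combine through (b +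
    c)^2 - (b - c)^2 = 4bc. *)
Lemma gauss_int1 : M (fun=> 1) = pi%:C / a%:C * cexp (b * c / a%:C).
Proof.
have -> : (fun=> 1) =
    (fun w : R[i] => (complex.Re w)%:C ^+ 0 * (complex.Im w)%:C ^+ 0).
  by apply/funext => w; rewrite !expr0 mulr1.
rewrite gauss_int_monomial !gauss_moment0// mulrACA -rmorphM -expr2 sqr_sqrtr;
  last first.
  by rewrite divr_ge0// ?pi_ge0// ltW.
have aC0 : a%:C != 0 :> R[i] by rewrite fmorph_eq0 gt_eqF.
rewrite rmorphM fmorphV -cexpD; congr (_ * cexp _).
by rewrite rmorphM rmorph_nat; field: (mulii (R := R)).
Qed.

Lemma gauss_integrable_xy_poly f fx fy : xy_poly f fx fy -> [/\ integ f, integ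
  fx & integ fy].
Proof.
elim=> [k p q|{}f {}fx {}fy g gx gy _ [fi fxi fyi] _ [gi gxi gyi]]; last first.
  by split; exact: gauss_integrableD.
by split; apply: gauss_integrableZ; exact: gauss_integrable_monomial.
Qed.

(** Integration by parts in each coordinate: on a monomial it is the moment recursion in one factor,
    and it extends by linearity. *)
Lemma gauss_int_xy_poly f fx fy : xy_poly f fx fy ->
  (2 * a)%:C * M (fun w => (complex.Re w)%:C * f w) = (b + c) * M f + M fx /\
  (2 * a)%:C * M (fun w => (complex.Im w)%:C * f w) =
    'i%C * (b - c) * M f + M fy.
Proof.
elim=> [k p q|{}f {}fx {}fy g gx gy fP [fX fY] gP [gX gY]].
  have im := gauss_integrable_monomial.
  split.
  - have -> : (fun w : R[i] => (complex.Re w)%:C *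
        (k * ((complex.Re w)%:C ^+ p * (complex.Im w)%:C ^+ q))) =
      (fun w : R[i] => k * ((complex.Re w)%:C ^+ p.+1 * (complex.Im w)%:C ^+
        q)).
      by apply/funext => w; rewrite exprS; ring.
    rewrite !gauss_intZ// !gauss_int_monomial mulrCA [_%:C * (_ * _)]mulrA
      gauss_moment_rec//.
    ring.
  - have -> : (fun w : R[i] => (complex.Im w)%:C *
        (k * ((complex.Re w)%:C ^+ p * (complex.Im w)%:C ^+ q))) =
      (fun w : R[i] => k * ((complex.Re w)%:C ^+ p * (complex.Im w)%:C ^+
        q.+1)).
      by apply/funext => w; rewrite exprS; ring.
    rewrite !gauss_intZ// !gauss_int_monomial mulrCA [_%:C * (_ * _)]mulrCA
      gauss_moment_rec//.
    ring.
have [fi fxi fyi] := gauss_integrable_xy_poly fP; have [gi gxi gyi] :=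
  gauss_integrable_xy_poly gP.
have [fXi _ _] := gauss_integrable_xy_poly (xy_polyX fP).
have [gXi _ _] := gauss_integrable_xy_poly (xy_polyX gP).
have [fYi _ _] := gauss_integrable_xy_poly (xy_polyY fP).
have [gYi _ _] := gauss_integrable_xy_poly (xy_polyY gP).
split.
- under eq_fun do rewrite mulrDr.
  by rewrite !gauss_intD// mulrDr fX gX; ring.
- under eq_fun do rewrite mulrDr.
  by rewrite !gauss_intD// mulrDr fY gY; ring.
Qed.

Lemma gauss_integrable_wirtinger_poly f d db : wirtinger_poly f d db ->
  [/\ integ f, integ d & integ db].
Proof.
move=> fP; have [fi sumi difi] := gauss_integrable_xy_poly fP; split => //.
(* The Wirtinger derivatives are recovered from the partials as (fx - i fy) / 2 and (fx + i fy) /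
   2. *)
- have -> : d =
      (fun w => 2^-1 * ((d w + db w) + - 'i%C * ('i%C * (d w - db w)))).
    by apply/funext => w; field: (mulii (R := R)).
  exact/gauss_integrableZ/gauss_integrableD/gauss_integrableZ.
- have -> : db =
      (fun w => 2^-1 * ((d w + db w) + 'i%C * ('i%C * (d w - db w)))).
    by apply/funext => w; field: (mulii (R := R)).
  exact/gauss_integrableZ/gauss_integrableD/gauss_integrableZ.
Qed.

(** Integration by parts in Wirtinger form: the weight's derivative in conj w is (c - a w) times the
    weight. It is obtained by combining the two coordinate identities through w = x + iy and its
    conjugate. *)
Lemma gauss_int_wirtinger_poly f d db : wirtinger_poly f d db ->
  a%:C * M (fun w => w * f w) = c * M f + M db /\
  a%:C * M (fun w => Num.conj w * f w) = b * M f + M d.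
Proof.
move=> fP; have [fX fY] := gauss_int_xy_poly fP.
have [fi di dbi] := gauss_integrable_wirtinger_poly fP.
have [Xi _ _] := gauss_integrable_xy_poly (xy_polyX fP).
have [Yi _ _] := gauss_integrable_xy_poly (xy_polyY fP).
have dbiN : integ (fun w => - 1 * db w) by exact: gauss_integrableZ.
have addE : M (fun w => d w + db w) = M d + M db by exact: gauss_intD.
have subE : M (fun w => 'i%C * (d w - db w)) = 'i%C * (M d - M db).
  rewrite gauss_intZ; last by under eq_fun do rewrite -[db _]mul1r -mulNr;
    exact: gauss_integrableD.
  under eq_fun do rewrite -[db _]mul1r -mulNr.
  by rewrite gauss_intD// gauss_intZ// mulN1r.
have aE : a%:C = 2^-1 * (2 * a)%:C :> R[i].
  by rewrite rmorphM rmorph_nat mulKf.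
split.
- have -> : (fun w => w * f w) = (fun w => (complex.Re w)%:C * f w +
      'i%C * ((complex.Im w)%:C * f w)).
    by apply/funext => w; rewrite mulrA -mulrDl -complexE.
  rewrite gauss_intD//; last exact: gauss_integrableZ.
  rewrite gauss_intZ// aE mulrDr -mulrA fX mulrCA -[X in _ + _ * X]mulrA fY
    addE subE.
  by field: (mulii (R := R)).
- have -> : (fun w => Num.conj w * f w) = (fun w => (complex.Re w)%:C * f w +
      - 'i%C * ((complex.Im w)%:C * f w)).
    by apply/funext => w; rewrite mulrA -mulrDl mulNr -conjE.
  rewrite gauss_intD//; last exact: gauss_integrableZ.
  rewrite gauss_intZ// aE mulrDr -mulrA fX mulrCA -[X in _ + _ * X]mulrA fY
    addE subE.
  by field: (mulii (R := R)).
Qed.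

End PlaneGaussian.

(** * The Hermite integrals relative to the integral of the weight *)

Section HermiteMoments.
Context {R : realType}.
Variables (nu nu' d : R) (u v z : R[i]).
Hypotheses (nu'_gt0 : 0 < nu') (d_gt0 : 0 < d).
Hypothesis dE : d%:C = 1 - nu%:C * nu'%:C * (u * v).

Local Notation a := (nu' / d).
Local Notation b := (nu%:C * nu'%:C * u * z / d%:C).
Local Notation c := (nu%:C * nu'%:C * v * Num.conj z / d%:C).
Local Notation M := (gauss_int a b c).

Lemma gauss_int_hermite k j : M (hermite nu' k j) =
  nu'%:C ^+ (j + k) * u ^+ j * v ^+ k * hermite nu j k z * M (fun=> 1).
Proof.
have a_gt0 : 0 < a by rewrite divr_gt0.
have d0 : d%:C != 0 :> R[i] by rewrite fmorph_eq0 gt_eqF.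
have nu'0 : nu'%:C != 0 :> R[i] by rewrite fmorph_eq0 gt_eqF.
have aE : a%:C = nu'%:C / d%:C by rewrite rmorphM fmorphV.
(* Multiplication by d clears the denominators of a, b and c. *)
have IBP f e eb (fP : wirtinger_poly f e eb) :
    nu'%:C * M (fun w => w * f w) = nu%:C * nu'%:C * v * Num.conj z * M f +
      d%:C * M eb /\
    nu'%:C * M (fun w => Num.conj w * f w) = nu%:C * nu'%:C * u * z * M f +
      d%:C * M e.
  have [w1 w2] := gauss_int_wirtinger_poly b c a_gt0 fP.
  have nE : nu'%:C = d%:C * a%:C by rewrite aE mulrC divfK.
  split.
  - rewrite [LHS](_ : _ = d%:C * (a%:C * M (fun w => w * f w))).
      by rewrite w1; field.
    by rewrite mulrA -nE.
  - rewrite [LHS](_ : _ = d%:C * (a%:C * M (fun w => Num.conj w * f w))).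
      by rewrite w2; field.
    by rewrite mulrA -nE.
have hP m n := wirtinger_poly_hermite nu' m n.
have hi m n := gauss_integrable_wirtinger_poly b c a_gt0 (hP m n).
elim: k j => [|k IHk] j.
  elim: j => [|j IHj]; first by rewrite !expr0 !mul1r.
  have -> : hermite nu' 0 j.+1 =
      (fun w => nu'%:C * (Num.conj w * hermite nu' 0 j w)).
    by apply/funext => w; rewrite hermiteSr mul0r subr0.
  have [zi _ _] := gauss_integrable_wirtinger_poly b c a_gt0
    (wirtinger_poly_mulzc (hP 0 j)).
  rewrite gauss_intZ// (IBP _ _ _ (hP 0 j)).2 IHj.
  (* H_{0,j} has no derivative in w. The zero is written [0 * 1] to be pulled out of the integral of
     the constant 1, that is H_{0,0}. *)
  have -> : (fun w => nu'%:C * 0%:R * hermite nu' 0.-1 j w) = (fun w => 0 * 1).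
    by apply/funext => w; rewrite mulr0 !mul0r.
  have [oi _ _] := hi 0%N 0%N.
  rewrite gauss_intZ//= !addn0 !exprS; ring.
have [zi _ _] := gauss_integrable_wirtinger_poly b c a_gt0 (wirtinger_poly_mulz
  (hP k j)).
have [ji _ _] := hi k j.-1.
have -> : hermite nu' k.+1 j = (fun w => nu'%:C *
    (w * hermite nu' k j w + - j%:R * hermite nu' k j.-1 w)).
  by apply/funext => w; rewrite /= mulNr.
rewrite gauss_intZ; last by apply: gauss_integrableD => //; exact:
  gauss_integrableZ.
rewrite gauss_intD//; last exact: gauss_integrableZ.
(* The terms in H_{k,j-1} add up to the coefficient - (1 - d) nu' j, and 1 - d = nu nu' u v yields
   the lowering term of the mirror rule for H_{j,k+1}. *)
rewrite gauss_intZ// mulrDr (IBP _ _ _ (hP k j)).1 gauss_intZ// !IHk dE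
  hermiteSr.
case: j {zi ji} => [|j] /=; rewrite ?addnS ?addSn !exprS; ring.
Qed.

End HermiteMoments.

Theorem theorem4p5 (R : realType) (nu nu' : R) (u v : R[i])
    (nu'_gt0 : 0 < nu')
    (uv_real : u * v \is Num.real)
    (uv_lt1 : nu%:C * nu'%:C * (u * v) < 1)
    (j k : nat) (z : R[i]) :
  let D : R[i] := 1 - nu%:C * nu'%:C * (u * v) in
  let F : R[i] -> R[i] := fun w =>
    cexp ((- nu'%:C * `|w| ^+ 2
           + nu%:C * nu'%:C * (u * z * w + v * z^* * w^*)) / D)
    * cHermite k j nu' w in
  cintegrable F /\
  cintegral F =
    pi%:C * nu'%:C ^ ((j + k)%:Z - 1) * D * u ^+ j * v ^+ k
    * cexp (nu%:C ^+ 2 * nu'%:C * (u * v) / D * `|z| ^+ 2)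
    * cHermite j k nu z.
Proof.
move=> D F.
have /complex_realP[r uvE] := uv_real.
(* A real copy of [D], so that the Gaussian parameter a = nu' / d is a positive real. *)
pose d := 1 - nu * nu' * r.
have dE : d%:C = D by rewrite /D uvE /d rmorphB rmorph1 !rmorphM.
have d_gt0 : 0 < d by move: uv_lt1; rewrite -subr_gt0 -/D -dE ltcR.
have a_gt0 : 0 < nu' / d by rewrite divr_gt0.
have d0 : d%:C != 0 :> R[i] by rewrite fmorph_eq0 gt_eqF.
have nu'0 : nu'%:C != 0 :> R[i] by rewrite fmorph_eq0 gt_eqF.
pose b := nu%:C * nu'%:C * u * z / d%:C.
pose c := nu%:C * nu'%:C * v * z^* / d%:C.
(* Dividing the exponent by [D] term by term gives the weight with parameters a, b, c. *)
have FE : F = (fun w => hermite nu' k j w * plane_gauss (nu' / d) b c w).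
  apply/funext => w; rewrite /F mulrC cHermiteE plane_gaussE; congr (_ * cexp
    _).
  by rewrite -dE /b /c rmorphM fmorphV; field.
rewrite FE; split.
  by have [] := gauss_integrable_wirtinger_poly b c a_gt0
    (wirtinger_poly_hermite nu' k j).
rewrite -/(gauss_int _ _ _ _) (gauss_int_hermite z nu'_gt0 d_gt0 dE).
rewrite gauss_int1// cHermiteE -dE.
(* The integer exponent j + k - 1 is split; its factor 1 / nu' comes from pi / a = pi d / nu'. *)
rewrite expfzDr// -exprnP exprN1.
have -> : b * c / (nu' / d)%:C =
    nu%:C ^+ 2 * nu'%:C * (u * v) / d%:C * `|z| ^+ 2.
  rewrite normCK /b /c rmorphM fmorphV; field.
  by rewrite d0.
by rewrite rmorphM fmorphV; field; apply/andP; split; [exact: nu'0 | exact: d0].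
Qed.
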